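(* Let $n\ge 1$ and $0\le k\le n$ be integers. Then $$\begin{aligned}\begin{bmatrix} n\\ k\end{bmatrix}_{\mathcal{F}}={}&\sum_{i=0}^{n-k-2}\left\{ q^{F_{k+1}F_{n-k-i}}\,[F_{n-k-i-1}]_{q^{F_{k}}}\left(\prod_{j=1}^{i}[F_{k+1}]_{q^{F_{n-k-j+1}}}\right)\begin{bmatrix} n-i-1\\ k-1\end{bmatrix}_{\mathcal{F}}\right\}\\ &+\prod_{j=1}^{n-k}[F_{k+1}]_{q^{F_{n-k-j+1}}}.\end{aligned}$$
   Context: Fibonacci numbers: $F_0=0$, $F_1=1$, $F_n=F_{n-1}+F_{n-2}$. For an integer $m\ge 0$, $[m]_q=\sum_{i=0}^{m-1}q^i$ (so $[0]_q=0$), with $q$ an indeterminate, and $[m]_{q^s}=\sum_{i=0}^{m-1}q^{si}$ for an integer $s\ge 0$ (so $[m]_{q^0}=m$). Put $[F_m]_q!=\prod_{i=1}^m [F_i]_q$ (with $[F_0]_q!=1$). The $q$-Fibonomial coefficient is, for integers $0\le k\le n$, $$\begin{bmatrix} n\\ k\end{bmatrix}_{\mathcal{F}}=\frac{[F_n]_q!}{[F_k]_q!\,[F_{n-k}]_q!},$$ and it is $0$ if $k<0$. Empty sums (including those whose upper limit is less than the lower limit) are $0$ and empty products are $1$. *)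

(* Defs.v *)
From HB Require Import structures.
From mathcomp Require Import all_boot all_order all_algebra.

Set Implicit Arguments.
Unset Strict Implicit.
Unset Printing Implicit Defensive.

Import GRing.Theory.
Local Open Scope ring_scope.

Fixpoint fib (n : nat) : nat :=
  if n is n'.+1 then (if n' is n''.+1 then fib n' + fib n'' else 1)%N else 0%N.

(* The field Q(q) of rational functions, in which the quotients of products of
   q-integers are formed. *)
Definition Qq := {fraction {poly rat}}.

Definition q : Qq := FracField.tofrac 'X.

(* [m]_x; the paper's [m]_{q^s} is qint (q ^+ s) m, see qintX. *)
Definition qint (x : Qq) (m : nat) : Qq := \sum_(i < m) x ^+ i.

Lemma qintX (s m : nat) : qint (q ^+ s) m = \sum_(i < m) q ^+ (s * i).
Proof. by apply: eq_bigr => i _; rewrite exprM. Qed.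

Definition qfib_fact (m : nat) : Qq := \prod_(1 <= i < m.+1) qint q (fib i).

(* The lower index is an integer, as k - 1 = -1 occurs. The value 0 for k > n
   is only a convention. *)
Definition qfibonomial (n : nat) (k : int) : Qq :=
  match k with
  | Posz k' =>
      if (k' <= n)%N then qfib_fact n / (qfib_fact k' * qfib_fact (n - k'))
      else 0
  | Negz _ => 0
  end.

(* Main.v *)
(* With m = n - k >= 1, the identity F_n = F_(k+1) F_m + F_k F_(m-1) and the
   rules [a + b]_q = [a]_q + q^a [b]_q and [a b]_q = [a]_q [b]_(q^a) give
   a Pascal-like recurrence expressing the (n, k) coefficient through those of
   index (n-1, k-1) and (n-1, k). Iterating it on its last term until n = k
   yields the formula. *)
Require Import Defs.
From mathcomp Require Import all_boot all_order all_algebra.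
From mathcomp Require Import ring.

Import GRing.Theory.

Local Open Scope ring_scope.

Lemma fibSS n : fib n.+2 = (fib n.+1 + fib n)%N.
Proof. by []. Qed.

Lemma fib_gt0 n : (0 < fib n.+1)%N.
Proof. by elim: n => // n IHn; rewrite fibSS addn_gt0 IHn. Qed.

(** Induction on [m] for all [k] at once: the step moves one unit from [m] to [k]. *)
Lemma fib_addS k m : fib (k + m).+1 = (fib k.+1 * fib m.+1 + fib k * fib m)%N.
Proof.
elim: m k => [|m IHm] k; first by rewrite addn0 muln1 muln0 addn0.
by rewrite addnS -addSn IHm (fibSS m) (fibSS k); ring.
Qed.

Lemma qint0 x : qint x 0 = 0.
Proof. exact: big_ord0. Qed.

Lemma qint1 x : qint x 1 = 1.
Proof. by rewrite /qint big_ord1. Qed.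

Lemma qint_add x a b : qint x (a + b) = qint x a + x ^+ a * qint x b.
Proof.
rewrite /qint big_split_ord mulr_sumr; congr (_ + _).
by apply: eq_bigr => i _; rewrite exprD.
Qed.

Lemma qint_mul x a b : qint x (a * b) = qint x a * qint (x ^+ a) b.
Proof.
elim: b => [|b IHb]; first by rewrite muln0 !qint0 mulr0.
by rewrite mulnSr -[b.+1]addn1 !qint_add IHb qint1 mulr1 mulrDr -exprM [x ^+ _ * _]mulrC.
Qed.

(** This is the image of a polynomial with constant coefficient 1, and [tofrac] is injective. *)
Lemma qint_q_neq0 m : (0 < m)%N -> qint q m != 0.
Proof.
case: m => // m _.
have -> : qint q m.+1 = FracField.tofrac (\sum_(i < m.+1) 'X^i : {poly rat}).
  by rewrite rmorph_sum; apply: eq_bigr => i _; rewrite rmorphXn.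
rewrite tofrac_eq0; apply/eqP => /(congr1 (fun p : {poly rat} => p`_0)).
rewrite coef0 big_ord_recl coefD coef1 coef_sum big1 ?addr0 => [/eqP|i _].
  by rewrite oner_eq0.
by rewrite coefXn.
Qed.

Lemma qfib_fact0 : qfib_fact 0 = 1.
Proof. by rewrite /qfib_fact big_nil. Qed.

Lemma qfib_factS m : qfib_fact m.+1 = qfib_fact m * qint q (fib m.+1).
Proof. by rewrite /qfib_fact big_nat_recr. Qed.

Lemma qfib_fact_neq0 m : qfib_fact m != 0.
Proof.
elim: m => [|m IHm]; first by rewrite qfib_fact0 oner_neq0.
rewrite qfib_factS; exact: mulf_neq0 IHm (qint_q_neq0 _ (fib_gt0 m)).
Qed.

Lemma qfibonomialD k m :
  qfibonomial (k + m) k%:Z = qfib_fact (k + m) / (qfib_fact k * qfib_fact m).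
Proof. by rewrite /qfibonomial leq_addr addKn. Qed.

Lemma qfibonomial0 m : qfibonomial m 0%:Z = 1.
Proof.
rewrite -[m]add0n qfibonomialD qfib_fact0 mul1r add0n.
exact: divff (qfib_fact_neq0 m).
Qed.

(* Stated over an abstract field, since [field] does not terminate on [Qq]. *)
Lemma pascal_cross_mul (F : fieldType) (N K M a b c d x : F) :
    K != 0 -> M != 0 -> b != 0 -> d != 0 ->
  N * (b * a + x * (d * c)) / (K * d * (M * b)) =
    x * c * (N / (K * (M * b))) + a * (N / (K * d * M)).
Proof. by move=> K0 M0 b0 d0; field; rewrite K0 M0 b0 d0. Qed.

Lemma qfibonomial_rec k m :
  qfibonomial (k + m).+1 k%:Z =
    q ^+ (fib k.+1 * fib m.+1) * qint (q ^+ fib k) (fib m)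
      * qfibonomial (k + m) (k%:Z - 1)
    + qint (q ^+ fib m.+1) (fib k.+1) * qfibonomial (k + m) k%:Z.
Proof.
case: k => [|k].
  (* The lower index -1 makes the first term 0, and $F_1 = 1$ makes the other coefficient 1. *)
  by rewrite !qfibonomial0 qint1 mulr1 mulr0 add0r.
have -> : k.+1%:Z - 1 = k%:Z by rewrite -addn1 PoszD addrK.
rewrite -addnS qfibonomialD [X in qfibonomial X k%:Z]addSnnS !qfibonomialD.
rewrite -addSnnS addnS (qfib_factS (k.+1 + m)) fib_addS qint_add.
(* [qint_mul] keeps base [q] only on the first factor. The swap puts [fib m.+1] there, so that it
   cancels against the last factor of [qfib_fact m.+1]. *)
rewrite (mulnC (fib k.+2)) !qint_mul (qfib_factS k) (qfib_factS m).
exact: pascal_cross_mul (qfib_fact_neq0 k) (qfib_fact_neq0 m)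
  (qint_q_neq0 _ (fib_gt0 m)) (qint_q_neq0 _ (fib_gt0 k)).
Qed.

(* The last summand is 0 as [F_0] = 0, so the range is one longer than in the
   theorem; this way the induction needs no special case m = 1. *)
Lemma qfibonomial_expansion k m :
  qfibonomial (k + m) k%:Z =
    \sum_(0 <= i < m)
      (q ^+ (fib k.+1 * fib (m - i)) * qint (q ^+ fib k) (fib (m - i - 1))
       * (\prod_(1 <= j < i.+1) qint (q ^+ fib (m - j + 1)) (fib k.+1))
       * qfibonomial (k + m - i - 1) (k%:Z - 1))
    + \prod_(1 <= j < m.+1) qint (q ^+ fib (m - j + 1)) (fib k.+1).
Proof.
(* The factor $j = 1$ split off here is the coefficient by which the recurrence multiplies the
   induction hypothesis. *)
have prodS i p : \prod_(1 <= j < i.+2) qint (q ^+ fib (p.+1 - j + 1)) (fib k.+1)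
    = qint (q ^+ fib p.+1) (fib k.+1)
      * \prod_(1 <= j < i.+1) qint (q ^+ fib (p - j + 1)) (fib k.+1).
  by rewrite big_nat_recl // subn1 addn1.
elim: m => [|m IHm].
  by rewrite !big_nil qfibonomialD addn0 qfib_fact0 mulr1 add0r divff ?qfib_fact_neq0.
rewrite addnS qfibonomial_rec IHm mulrDr addrA prodS; congr (_ + _).
(* The summand $i = 0$ is the first term of the recurrence; the others are those of the induction
   hypothesis, shifted by one. *)
rewrite big_nat_recl // big_nil mulr1 !subn0 !subn1 /=; congr (_ + _).
rewrite mulr_sumr; apply: eq_bigr => i _.
by rewrite prodS !subSS mulrA [X in X * _ = _]mulrCA.
Qed.

Theorem proposition3p5 (n k : nat) (hn : (1 <= n)%N) (hk : (k <= n)%N) :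
  qfibonomial n k%:Z =
    \sum_(0 <= i < n - k - 1)
      (q ^+ (fib (k + 1) * fib (n - k - i))
       * qint (q ^+ fib k) (fib (n - k - i - 1))
       * (\prod_(1 <= j < i.+1) qint (q ^+ fib (n - k - j + 1)) (fib (k + 1)))
       * qfibonomial (n - i - 1) (k%:Z - 1))
    + \prod_(1 <= j < (n - k).+1) qint (q ^+ fib (n - k - j + 1)) (fib (k + 1)).
Proof.
rewrite -{1}(subnKC hk) qfibonomial_expansion subnKC // addn1; congr (_ + _).
(* If $n = k$, truncated subtraction makes both ranges empty; otherwise the surplus summand $i = m$
   contains $[F_0] = 0$. *)
case: (n - k)%N => [|m]; first by rewrite !big_nil.
by rewrite subn1 big_nat_recr //= subSnn subnn qint0 mulr0 !mul0r addr0.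
Qed.
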